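(* Let $(\Omega_1,\mu)$ and $(\Omega_2,\nu)$ be arbitrary measure spaces with positive measures $\mu$ and $\nu$. Then the pair $(L_\infty(\mu), L_1(\nu))$ has the Bishop-Phelps-Bollobás property for positive operators. Moreover, the elements in the definition of this property can be chosen to preserve positivity of the point: for every $0<\varepsilon<1$ there exists $0<\eta(\varepsilon)<\varepsilon$ such that for every positive operator $S\in S_{L(L_\infty(\mu),L_1(\nu))}$ and every $f_0\in S_{L_\infty(\mu)}$ with $\|S(f_0)\|_1>1-\eta(\varepsilon)$, there exist $f_1\in S_{L_\infty(\mu)}$ and a positive operator $T\in S_{L(L_\infty(\mu),L_1(\nu))}$ such that $\|T(f_1)\|_1=1$, $\|f_1-f_0\|_\infty<\varepsilon$, $\|T-S\|<\varepsilon$, and, if $f_0\ge 0$, then also $f_1\ge 0$.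
   Context: All spaces are real. $L_\infty(\mu)$ is the space of real-valued measurable essentially bounded functions with the essential supremum norm $\|\cdot\|_\infty$, and $L_1(\nu)$ is the space of real-valued $\nu$-integrable functions with its usual norm $\|\cdot\|_1$; both are Banach lattices under the almost everywhere pointwise order. For a Banach space $X$, $S_X$ denotes its unit sphere. $L(X,Y)$ is the space of bounded linear operators from $X$ to $Y$ with the operator norm. A linear operator $T:X\to Y$ between ordered vector spaces is positive (written $T\ge 0$) if $x\ge 0$ implies $Tx\ge 0$. An element $x$ of an ordered vector space is called positive if $x\ge 0$. Definition. Let $X$ and $Y$ be Banach lattices. The pair $(X,Y)$ has the Bishop-Phelps-Bollobás property for positive operators if for every $0<\varepsilon<1$ there exists $0<\eta(\varepsilon)<\varepsilon$ such that for every $S\in S_{L(X,Y)}$ with $S\ge 0$, if $x_0\in S_X$ satisfies $\|S(x_0)\|>1-\eta(\varepsilon)$, then there exist an element $u_0\in S_X$ and a positive operator $T\in S_{L(X,Y)}$ such that $\|T(u_0)\|=1$, $\|u_0-x_0\|<\varepsilon$ and $\|T-S\|<\varepsilon$. *)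

(* Defs.v *)
From HB Require Import structures.
From mathcomp Require Import all_boot all_order all_algebra.
From mathcomp Require Import all_classical all_reals all_analysis.
From mathcomp Require Import measurable_realfun ess_sup_inf ring lra.

Set Implicit Arguments.
Unset Strict Implicit.
Unset Printing Implicit Defensive.

Import Order.TTheory GRing.Theory Num.Theory.
Import numFieldNormedType.Exports.

Local Open Scope classical_set_scope.
Local Open Scope ring_scope.

(* The lattice order is part of the structure itself: a join of normedModType
   with the order structures of MathComp cannot be declared, because
   numDomainType already inherits from both sides. *)
Reserved Notation "x <=L y" (at level 70, y at next level).

HB.mixin Record CompleteNormedModule_isBanachLattice (R : realType) E
    of CompleteNormedModule R E := {
  blatt_le : E -> E -> Prop ;
  blatt_sup : E -> E -> E ;
  blatt_inf : E -> E -> E ;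
  blatt_le_refl : forall x, blatt_le x x ;
  blatt_le_anti : forall x y, blatt_le x y -> blatt_le y x -> x = y ;
  blatt_le_trans : forall y x z, blatt_le x y -> blatt_le y z -> blatt_le x z ;
  blatt_supP : forall x y z,
    blatt_le (blatt_sup x y) z <-> blatt_le x z /\ blatt_le y z ;
  blatt_infP : forall x y z,
    blatt_le z (blatt_inf x y) <-> blatt_le z x /\ blatt_le z y ;
  blatt_leD2r : forall z x y, blatt_le x y -> blatt_le (x + z) (y + z) ;
  blatt_scale_ge0 : forall (a : R) x,
    0 <= a -> blatt_le 0 x -> blatt_le 0 (a *: x) ;
  blatt_le_norm : forall x y,
    blatt_le (blatt_sup x (- x)) (blatt_sup y (- y)) -> `|x| <= `|y|
}.

#[short(type="banachLatticeType")]
HB.structure Definition BanachLattice (R : realType) :=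
  {E of CompleteNormedModule R E & CompleteNormedModule_isBanachLattice R E}.

Notation "x <=L y" := (blatt_le x y) : ring_scope.

(* LspaceType mu p1 is the set of almost-everywhere classes of measurable
   real functions with finite p-norm; it comes with no algebraic structure. It
   is made below into a Banach lattice: vector operations, sup and inf are the
   classes of the pointwise operations on representatives, the norm is the
   p-norm (Lspace_normrE) and the order is almost everywhere (Lspace_leE). *)
Section Lspace_basic.
Context d (T : measurableType d) (R : realType).
Variables (mu : {measure set T -> \bar R}) (p : \bar R) (p1 : (1 <= p)%E).
Local Notation L := (LspaceType mu p1).
Implicit Types u v w : L.

HB.instance Definition _ := gen_eqMixin L.
HB.instance Definition _ := gen_choiceMixin L.

Lemma Lspace_measurable u : measurable_fun [set: T] (u : T -> R).
Proof.
move=> mT Y mY.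
exact: (@measurable_funPT _ _ _ _ (repr (u : {mfun_ mu, T >-> measurableTypeR R}))).
Qed.

Lemma Lspace_Lfun u : (u : T -> R) \in Lfun mu p.
Proof.
rewrite inE/=; apply/andP; split; rewrite inE/=; first exact: Lspace_measurable.
exact: Lebesgue_finite.
Qed.

Lemma Lspace_eqP u v : u = v <-> (\forall x \ae mu, (u : T -> R) x = (v : T -> R) x).
Proof.
split=> [->|uv]; first exact/nearW.
have /eqP : (u : {mfun_ mu, T >-> measurableTypeR R}) = v.
  have /ae_eqP : (u : {mfun_ mu, T >-> measurableTypeR R}) = v %[ae mu].
    by apply: filterS uv => x ->.
  by move=> /eqP; rewrite !reprK.
case: u v uv => [u [[mu1]]] [v [[mv1]]] _ /eqP /= uv; subst v.
by rewrite (Prop_irrelevance mu1 mv1).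
Qed.

Lemma ae_le_Lnorm (f g : T -> R) :
  measurable_fun [set: T] f -> measurable_fun [set: T] g ->
  (\forall x \ae mu, `|f x| <= `|g x|) ->
  ('N[mu]_p[EFin \o f] <= 'N[mu]_p[EFin \o g])%E.
Proof.
move=> mf mg fg; rewrite unlock; case: p p1 => [r|//|//] r1 /=.
  rewrite gt0_ler_poweR ?in_itv/= ?leey ?integral_ge0//.
    by rewrite invr_ge0 (le_trans ler01).
  apply: ae_ge0_le_integral => //=.
  - apply/measurable_EFinP.
    apply: (@measurableT_comp _ _ _ _ _ _ (@powR R ^~ r)) => //.
    exact: measurableT_comp.
  - apply/measurable_EFinP.
    apply: (@measurableT_comp _ _ _ _ _ _ (@powR R ^~ r)) => //.
    exact: measurableT_comp.
  - apply: filterS fg => x fgx _.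
    by rewrite lee_fin ge0_ler_powR ?nnegrE// (le_trans ler01).
case: ifPn => // _; apply: le_ess_sup.
by apply: filterS fg => x /=; rewrite lee_fin.
Qed.

Section mk.
Variables (f : T -> R) (fL : f \in Lfun mu p).

Let mf : measurable_fun [set: T] (f : T -> measurableTypeR R).
Proof. by case/andP : (fL) => /[!inE] mf _ mT Y mY; exact: mf. Qed.

Let F : {mfun T >-> measurableTypeR R} :=
  HB.pack (f : T -> measurableTypeR R) (isMeasurableFun.Build _ _ _ _ _ mf).

Let F' : {mfun_ mu, T >-> measurableTypeR R} := (\pi F)%qT.

Let F'E : (F' : T -> R) = f %[ae mu].
Proof.
have : (repr F' = F %[mod {mfun_ mu, T >-> measurableTypeR R}])%qT.
  by rewrite /F' reprK.
by move/eqmodP/asboolP.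
Qed.

Let F'fin : finite_norm mu p F'.
Proof.
case/andP : fL => _ /[!inE]/= ff; apply: le_lt_trans ff.
apply: ae_le_Lnorm => //.
- by move=> mT Y mY; exact: (@measurable_funPT _ _ _ _ (repr F')).
- by apply: filterS F'E => x /(_ I) ->.
Qed.

Let Lspace_mk_subproof : exists F : L, \forall x \ae mu, (F : T -> R) x = f x.
Proof.
pose F0 : L := HB.pack F' (isFinLebesgue.Build _ _ _ _ _ p1 _ F'fin).
exists F0.
by apply: filterS F'E => x /(_ I).
Qed.

Definition Lspace_mk : L := sval (cid Lspace_mk_subproof).

Lemma Lspace_mkE : \forall x \ae mu, (Lspace_mk : T -> R) x = f x.
Proof. exact: svalP (cid Lspace_mk_subproof). Qed.

End mk.

Lemma Lspace_inj u v :
  (\forall x \ae mu, (u : T -> R) x = (v : T -> R) x) -> u = v.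
Proof. by move/Lspace_eqP. Qed.

Lemma Lfun_add u v : (u : T -> R) \+ (v : T -> R) \in Lfun mu p.
Proof. by have [_ +] := Lfun_addr_closed mu p1; apply; exact: Lspace_Lfun. Qed.

Lemma Lfun_opp u : \- (u : T -> R) \in Lfun mu p.
Proof. exact: (Lfun_oppr_closed (Lspace_Lfun u)). Qed.

Lemma Lfun_zero : (cst 0 : T -> R) \in Lfun mu p.
Proof. by have [+ _] := Lfun_addr_closed mu p1. Qed.

Lemma Lfun_scal (a : R) u : (fun x => a * (u : T -> R) x) \in Lfun mu p.
Proof.
have [L0 +] := Lfun_submod_closed mu p1.
by move=> /(_ a u 0 (Lspace_Lfun u) L0); rewrite addr0.
Qed.

Lemma ae_le_Lfun (f g : T -> R) : measurable_fun [set: T] f ->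
  g \in Lfun mu p -> (\forall x \ae mu, `|f x| <= `|g x|) -> f \in Lfun mu p.
Proof.
move=> mf /andP[/[!inE]/= mg gfin] fg; apply/andP; split; rewrite inE//=.
by apply: le_lt_trans gfin; exact: ae_le_Lnorm.
Qed.

Lemma Lfun_norm_add u v :
  (fun x => `|(u : T -> R) x| + `|(v : T -> R) x|) \in Lfun mu p.
Proof.
have H w : (fun x => `|(w : T -> R) x|) \in Lfun mu p.
  apply: (ae_le_Lfun _ (Lspace_Lfun w)).
    exact: measurableT_comp (Lspace_measurable w).
  by apply: nearW => x; rewrite normr_id.
by have [_ +] := Lfun_addr_closed mu p1; apply; exact: H.
Qed.

Lemma Lfun_max u v :
  (fun x => Num.max ((u : T -> R) x) ((v : T -> R) x)) \in Lfun mu p.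
Proof.
apply: (ae_le_Lfun _ (Lfun_norm_add u v)).
  by apply: measurable_maxr; exact: Lspace_measurable.
apply: nearW => x; rewrite [leRHS]ger0_norm ?addr_ge0//.
by rewrite /Num.max; case: ifP => _; rewrite ?lerDl ?lerDr.
Qed.

Lemma Lfun_min u v :
  (fun x => Num.min ((u : T -> R) x) ((v : T -> R) x)) \in Lfun mu p.
Proof.
apply: (ae_le_Lfun _ (Lfun_norm_add u v)).
  by apply: measurable_minr; exact: Lspace_measurable.
apply: nearW => x; rewrite [leRHS]ger0_norm ?addr_ge0//.
by rewrite /Num.min; case: ifP => _; rewrite ?lerDl ?lerDr.
Qed.

Definition Lspace_zero : L := Lspace_mk Lfun_zero.
Definition Lspace_opp u : L := Lspace_mk (Lfun_opp u).
Definition Lspace_add u v : L := Lspace_mk (Lfun_add u v).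
Definition Lspace_scale (a : R) u : L := Lspace_mk (Lfun_scal a u).
Definition Lspace_sup u v : L := Lspace_mk (Lfun_max u v).
Definition Lspace_inf u v : L := Lspace_mk (Lfun_min u v).

Let addE u v : \forall x \ae mu,
  (Lspace_add u v : T -> R) x = (u : T -> R) x + (v : T -> R) x.
Proof. exact: Lspace_mkE. Qed.
Let oppE u : \forall x \ae mu, (Lspace_opp u : T -> R) x = - (u : T -> R) x.
Proof. exact: Lspace_mkE. Qed.
Let zeroE : \forall x \ae mu, (Lspace_zero : T -> R) x = 0.
Proof. exact: Lspace_mkE. Qed.
Let scaleE a u : \forall x \ae mu,
  (Lspace_scale a u : T -> R) x = a * (u : T -> R) x.
Proof. exact: Lspace_mkE. Qed.

Let LaddA : associative Lspace_add.
Proof.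
move=> u v w; apply: Lspace_inj.
have H1 := addE u (Lspace_add v w); have H2 := addE v w.
have H3 := addE (Lspace_add u v) w; have H4 := addE u v.
by apply: filterS (filterI H1 (filterI H2 (filterI H3 H4))) => x /= [-> [-> [-> ->]]]; rewrite addrA.
Qed.

Let LaddC : commutative Lspace_add.
Proof.
move=> u v; apply: Lspace_inj; have H1 := addE u v; have H2 := addE v u.
by apply: filterS (filterI H1 H2) => x /= [-> ->]; rewrite addrC.
Qed.

Let Ladd0 : left_id Lspace_zero Lspace_add.
Proof.
move=> u; apply: Lspace_inj; have H1 := addE Lspace_zero u.
by apply: filterS (filterI H1 zeroE) => x /= [-> ->]; rewrite add0r.
Qed.

Let LaddN : left_inverse Lspace_zero Lspace_opp Lspace_add.
Proof.
move=> u; apply: Lspace_inj; have H1 := addE (Lspace_opp u) u.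
have H2 := oppE u.
by apply: filterS (filterI H1 (filterI zeroE H2)) => x /= [-> [-> ->]]; rewrite addNr.
Qed.

HB.instance Definition _ := GRing.isZmodule.Build L LaddA LaddC Ladd0 LaddN.

Let LscaleA a b u : Lspace_scale a (Lspace_scale b u) = Lspace_scale (a * b) u.
Proof.
apply: Lspace_inj; have H1 := scaleE a (Lspace_scale b u).
have H2 := scaleE b u; have H3 := scaleE (a * b) u.
by apply: filterS (filterI H1 (filterI H2 H3)) => x /= [-> [-> ->]]; rewrite mulrA.
Qed.

Let Lscale1 : left_id 1 Lspace_scale.
Proof.
move=> u; apply: Lspace_inj; have H1 := scaleE 1 u.
by apply: filterS H1 => x /= ->; rewrite mul1r.
Qed.

Let LscaleDr : right_distributive Lspace_scale +%R.
Proof.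
move=> a u v; apply: Lspace_inj.
have H1 := scaleE a (u + v); have H2 := addE u v.
have H3 := addE (Lspace_scale a u) (Lspace_scale a v).
have H4 := scaleE a u; have H5 := scaleE a v.
by apply: filterS (filterI H1 (filterI H2 (filterI H3 (filterI H4 H5)))) => x /= [-> [-> [-> [-> ->]]]]; rewrite mulrDr.
Qed.

Let LscaleDl u : {morph Lspace_scale^~ u : a b / a + b}.
Proof.
move=> a b /=; apply: Lspace_inj.
have H1 := scaleE (a + b) u; have H2 := addE (Lspace_scale a u) (Lspace_scale b u).
have H3 := scaleE a u; have H4 := scaleE b u.
by apply: filterS (filterI H1 (filterI H2 (filterI H3 H4))) => x /= [-> [-> [-> ->]]]; rewrite mulrDl.
Qed.

HB.instance Definition _ :=
  GRing.Zmodule_isLmodule.Build R L LscaleA Lscale1 LscaleDr LscaleDl.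

Lemma Lspace0E : \forall x \ae mu, ((0 : L) : T -> R) x = 0.
Proof. exact: zeroE. Qed.

Lemma LspaceDE u v : \forall x \ae mu,
  ((u + v : L) : T -> R) x = (u : T -> R) x + (v : T -> R) x.
Proof. exact: addE. Qed.

Lemma LspaceNE u : \forall x \ae mu, ((- u : L) : T -> R) x = - (u : T -> R) x.
Proof. exact: oppE. Qed.

Lemma LspaceBE u v : \forall x \ae mu,
  ((u - v : L) : T -> R) x = (u : T -> R) x - (v : T -> R) x.
Proof.
have H1 := LspaceDE u (- v); have H2 := LspaceNE v.
by apply: filterS (filterI H1 H2) => x /= [-> ->].
Qed.

Lemma LspaceZE (a : R) u : \forall x \ae mu,
  ((a *: u : L) : T -> R) x = a * (u : T -> R) x.
Proof. exact: scaleE. Qed.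

Definition Lspace_norm u : R := fine ('N[mu]_p[EFin \o (u : T -> R)]).

Lemma Lspace_normE u :
  (Lspace_norm u)%:E = ('N[mu]_p[EFin \o (u : T -> R)])%E.
Proof.
by rewrite /Lspace_norm fineK// ge0_fin_numE ?Lnorm_ge0//; exact: Lebesgue_finite.
Qed.

Lemma ae_le_Lspace_norm u v :
  (\forall x \ae mu, `|(u : T -> R) x| <= `|(v : T -> R) x|) ->
  Lspace_norm u <= Lspace_norm v.
Proof.
move=> uv; rewrite -lee_fin !Lspace_normE.
by apply: ae_le_Lnorm => //; exact: Lspace_measurable.
Qed.

Let Lnorm_triangle u v : Lspace_norm (u + v) <= Lspace_norm u + Lspace_norm v.
Proof.
rewrite -lee_fin EFinD !Lspace_normE.
have := eminkowski mu (Lspace_measurable u) (Lspace_measurable v) p1.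
apply: le_trans; apply: ae_le_Lnorm; first exact: Lspace_measurable.
  by apply: measurable_funD; exact: Lspace_measurable.
by apply: filterS (LspaceDE u v) => x ->.
Qed.

Let Lnorm_scale (a : R) u : Lspace_norm (a *: u) = `|a| * Lspace_norm u.
Proof.
apply: EFin_inj; rewrite EFinM !Lspace_normE.
rewrite -(LnormZ (Lfun_Sub p1 (Lspace_Lfun u)) a).
have mu1 := Lspace_measurable u; have mau := Lspace_measurable (a *: u).
have mau' : measurable_fun [set: T] (a \*: (u : T -> R)).
  exact: measurable_funM.
by apply/eqP; rewrite eq_le; apply/andP; split; apply: ae_le_Lnorm => //;
  apply: filterS (LspaceZE a u) => x ->.
Qed.

Let Lnorm_eq0 u : Lspace_norm u = 0 -> u = 0.
Proof.
move=> u0; apply: Lspace_inj.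
have : ('N[mu]_p[EFin \o (u : T -> R)] = 0)%E by rewrite -Lspace_normE u0.
have mu1 : measurable_fun [set: T] (EFin \o (u : T -> R)).
  exact/measurable_EFinP/Lspace_measurable.
move/(Lnorm_eq0_eq0 mu1 (lt_le_trans lte01 p1)) => uE.
by apply: filterS (filterI Lspace0E uE) => x /= [-> /(_ I) []].
Qed.

HB.instance Definition _ :=
  Lmodule_isNormed.Build R L Lnorm_triangle Lnorm_scale Lnorm_eq0.

End Lspace_basic.

Section Lspace_complete.
Context d (T : measurableType d) (R : realType).
Variables (mu : {measure set T -> \bar R}) (p : \bar R) (p1 : (1 <= p)%E).
Local Notation L := (LspaceType mu p1).

Let poweR_limn_einf (y_ : nat -> \bar R) (y : \bar R) (r : R) : 0 < r ->
  (forall n, (0 <= y_ n)%E) -> y_ @ \oo --> y ->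
  (y `^ r <= limn_einf (fun n => y_ n `^ r))%E.
Proof.
move=> r0 y_0 yy; set l := limn_einf _.
have lE n : (einfs (fun n => y_ n `^ r)%E n <= l)%E.
  rewrite /l limn_einf_lim; apply: lime_ge; first exact: is_cvg_einfs.
  near=> m; apply: nondecreasing_einfs.
  by near: m; exact: nbhs_infty_ge.
have l0 : (0 <= l)%E.
  apply: le_trans (lE 0%N); apply: le_ereal_inf_tmp => _ [m _ <-].
  exact: poweR_ge0.
have y0 : (0 <= y)%E.
  rewrite -(cvg_lim _ yy)//; apply: lime_ge; first by apply/cvg_ex; exists y.
  exact: nearW.
have powK (z : \bar R) : (0 <= z)%E -> ((z `^ r^-1) `^ r = z)%E.
  by move=> z0; rewrite -poweRrM mulVf ?gt_eqF// poweRe1.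
have mono (a b : \bar R) : (0 <= a)%E -> (a <= b)%E -> (a `^ r <= b `^ r)%E.
  move=> a0 ab; apply: gt0_ler_poweR => //; rewrite ?(ltW r0)//.
    by rewrite in_itv/= a0 leey.
  by rewrite in_itv/= (le_trans a0 ab) leey.
rewrite leNgt; apply/negP => ly.
have : (l `^ r^-1 < y)%E.
  rewrite ltNge; apply/negP => yl; move: ly; apply/negP; rewrite -leNgt.
  by rewrite -[leRHS](powK _ l0) mono.
set a := (l `^ r^-1)%E => ay.
have a0 : (0 <= a)%E by exact: poweR_ge0.
have [t /andP[at_ ty]] : exists t : \bar R, (a < t < y)%E.
  have afin : a \is a fin_num by rewrite ge0_fin_numE// (lt_le_trans ay) ?leey.
  case: y ay {yy y0 ly} => [y| |] ay.
  - have h : fine a < y by rewrite -lte_fin fineK.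
    exists ((fine a + y) / 2)%:E; rewrite -{1}(fineK afin) !lte_fin.
    by apply/andP; split; lra.
  - exists (fine a + 1)%:E; rewrite -{1}(fineK afin) lte_fin ltry andbT.
    by rewrite ltrDl.
  - by move: ay; rewrite ltNge leNye.
have [N _ Nt] : \forall n \near \oo, (t < y_ n)%E.
  exact: (yy _ (open_ereal_gt' ty)).
have : (t `^ r <= l)%E.
  apply: le_trans (lE N); apply: le_ereal_inf_tmp => _ [m Nm <-].
  apply: mono; first exact: le_trans a0 (ltW at_).
  by apply: ltW; exact: Nt.
move=> tl; suff : (t <= a)%E by rewrite leNgt at_.
have -> : t = ((t `^ r) `^ r^-1)%E.
  by rewrite -poweRrM mulfV ?gt_eqF// poweRe1// (le_trans a0 (ltW at_)).
apply: gt0_ler_poweR => //; rewrite ?invr_ge0 ?(ltW r0)//.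
  by rewrite in_itv/= poweR_ge0 leey.
by rewrite in_itv/= l0 leey.
Unshelve. all: by end_near. Qed.

Let Lnorm_fatou (f_ : nat -> T -> \bar R) (f : T -> \bar R) (C : \bar R) :
  (forall n, measurable_fun [set: T] (f_ n)) -> measurable_fun [set: T] f ->
  (forall n, 'N[mu]_p[f_ n] <= C)%E ->
  (\forall x \ae mu, f_ ^~ x @ \oo --> f x) ->
  ('N[mu]_p[f] <= C)%E.
Proof.
move=> mf_ mf fC ff; have C0 : (0 <= C)%E by apply: le_trans (fC 0%N); exact: Lnorm_ge0.
have fabs : \forall x \ae mu, (fun n => `|f_ n x|%E) @ \oo --> `|f x|%E.
  by apply: filterS ff => x; exact: cvg_abse.
case: p p1 fC => [r|//|//] r1 fC.
  have r0 : 0 < r by rewrite (lt_le_trans ltr01).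
  have fCr n : (\int[mu]_x (`|f_ n x| `^ r) <= C `^ r)%E.
    rewrite -poweR_Lnorm ?gt_eqF//; apply: gt0_ler_poweR => //; rewrite ?(ltW r0)//.
      by rewrite in_itv/= Lnorm_ge0 leey.
    by rewrite in_itv/= C0 leey.
  have mfr n : measurable_fun [set: T] (fun x => `|f_ n x| `^ r)%E.
    exact: (measurableT_comp (@measurable_poweR _ r) (measurableT_comp _ (mf_ n))).
  have H : (\int[mu]_x (`|f x| `^ r) <= C `^ r)%E.
    apply: (@le_trans _ _ (\int[mu]_x limn_einf (fun n => `|f_ n x| `^ r))%E).
      apply: ae_ge0_le_integral => //.
      - by move=> x _; exact: poweR_ge0.
      - exact: (measurableT_comp (@measurable_poweR _ r) (measurableT_comp _ mf)).
      - move=> x _; rewrite limn_einf_lim; apply: lime_ge.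
          exact: is_cvg_einfs.
        by apply: nearW => n; apply: le_ereal_inf_tmp => _ [m _ <-]; exact: poweR_ge0.
      - under eq_fun do rewrite limn_einf_lim.
        apply: (emeasurable_fun_cvg (fun n x => einfs (fun n => `|f_ n x| `^ r)%E n)).
          by move=> n; apply: measurable_fun_einfs => m; exact: mfr.
        by move=> x _; exact: is_cvg_einfs.
      - by apply: filterS fabs => x fx _; exact: poweR_limn_einf.
    apply: le_trans (fatou _ _ _ _) _ => //.
      by move=> n x _; exact: poweR_ge0.
    rewrite limn_einf_lim; apply: lime_le; first exact: is_cvg_einfs.
    apply: nearW => n; apply: le_trans (fCr n); apply: ereal_inf_lbound.
    by exists n => //=.
  rewrite unlock.
  have -> : C = ((C `^ r) `^ r^-1)%E.
    by rewrite -poweRrM mulfV ?gt_eqF// poweRe1.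
  apply: gt0_ler_poweR => //; rewrite ?invr_ge0 ?(ltW r0)//.
    by rewrite in_itv/= leey integral_ge0// => x _; exact: poweR_ge0.
  by rewrite in_itv/= poweR_ge0 leey.
rewrite unlock; case: ifPn => // mu0; apply/ess_supP.
have : \forall x \ae mu, forall n, (`|f_ n x| <= C)%E.
  apply: ae_foralln => n; apply/ess_supP.
  by have := fC n; rewrite unlock mu0.
move=> H; apply: filterS (filterI H fabs) => x /= [fxC fx].
rewrite -(cvg_lim _ fx)//; apply: lime_le; first by apply/cvg_ex; eexists; exact: fx.
exact: nearW.
Qed.

Let Lnorm_fin (f : T -> \bar R) : measurable_fun [set: T] f ->
  ('N[mu]_p[f] < +oo)%E -> \forall x \ae mu, f x \is a fin_num.
Proof.
move=> mf; case: p p1 => [r|//|//] r1.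
  have r0 : 0 < r by rewrite (lt_le_trans ltr01).
  move=> /(poweR_lty r); rewrite poweR_Lnorm ?gt_eqF// => H.
  have /integrable_ae : mu.-integrable [set: T] (fun x => `|f x| `^ r)%E.
    apply/integrableP; split.
      exact: (measurableT_comp (@measurable_poweR _ r) (measurableT_comp _ mf)).
    by under eq_integral do rewrite gee0_abs ?poweR_ge0//.
  move=> /(_ measurableT); apply: filterS => x /(_ I).
  rewrite ge0_fin_numE ?poweR_ge0// => /lty_poweRy.
  by rewrite gt_eqF// => /(_ isT); rewrite -fin_num_abs.
rewrite unlock; case: ifPn => [mu0 H|].
  have := ess_sup_ge mu (abse \o f); apply: filterS => x /= fx.
  by rewrite fin_num_abs (le_lt_trans fx).
rewrite -leNgt => mu0 _; exists [set: T]; split => //.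
by apply/eqP; rewrite eq_le mu0 measure_ge0.
Qed.

Let geo_sum n : \sum_(k < n) 2^-1 ^+ k = 2 - 2 * 2^-1 ^+ n :> R.
Proof.
elim: n => [|n ih]; first by rewrite big_ord0 expr0 mulr1 subrr.
by rewrite big_ord_recr/= ih exprS; field.
Qed.

Let fast_cauchy (u : nat -> L) :
  (forall n, `|u n.+1 - u n| <= 2^-1 ^+ n) ->
  exists f : L, forall n, `|f - u n| <= 2 * 2^-1 ^+ n.
Proof.
move=> uc; have mu_ n := Lspace_measurable (u n).
have uB n m : `|u (n + m)%N - u n| <= 2 * 2^-1 ^+ n - 2 * 2^-1 ^+ (n + m).
  elim: m => [|m ih]; first by rewrite addn0 !subrr normr0.
  rewrite addnS -(subrKA (u (n + m)%N)) (le_trans (ler_normD _ _))//.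
  have := uc (n + m)%N; move: ih; rewrite exprS.
  by move: `|_| `|_| (_ ^+ n) (_ ^+ (n + m)) => a b c e; lra.
have {}uB n m : `|u (n + m)%N - u n| <= 2 * 2^-1 ^+ n.
  by apply: le_trans (uB n m) _; rewrite gerBl mulr_ge0// exprn_ge0// invr_ge0.
pose D k x : R := `|(u k.+1 : T -> R) x - (u k : T -> R) x|.
have mD k : measurable_fun [set: T] (D k).
  by apply: measurableT_comp => //; exact: measurable_funB.
have DN k : ('N[mu]_p[EFin \o D k] <= (2^-1 ^+ k)%:E)%E.
  have := uc k; rewrite -lee_fin => /(le_trans _); apply.
  rewrite [leRHS]Lspace_normE; apply: ae_le_Lnorm => //.
    exact: Lspace_measurable.
  by apply: filterS (LspaceBE (u k.+1) (u k)) => x ->; rewrite normr_id.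
pose G n x : R := \sum_(k < n) D k x.
have mG n : measurable_fun [set: T] (G n) by exact: measurable_sum.
have GN n : ('N[mu]_p[EFin \o G n] <= (\sum_(k < n) 2^-1 ^+ k)%:E)%E.
  elim: n => [|n ih].
    rewrite big_ord0; have -> : EFin \o G 0%N = cst 0%E.
      by apply/funext => x; rewrite /= /G big_ord0.
    by rewrite Lnorm0// gt_eqF// (lt_le_trans lte01).
  have -> : G n.+1 = G n \+ D n.
    by apply/funext => x; rewrite /G big_ord_recr.
  by rewrite big_ord_recr/= EFinD (le_trans (eminkowski _ _ _ _))// leeD.
have {}GN n : ('N[mu]_p[EFin \o G n] <= 2%:E)%E.
  apply: le_trans (GN n) _; rewrite lee_fin geo_sum gerBl.
  by rewrite mulr_ge0// exprn_ge0// invr_ge0.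
pose g x : \bar R := (\sum_(0 <= k <oo) (D k x)%:E)%E.
have Gg x : (EFin \o G ^~ x) @ \oo --> g x.
  rewrite (_ : _ \o _ = fun n => (\sum_(0 <= k < n) (D k x)%:E)%E); last first.
    by apply/funext => n; rewrite /= /G big_mkord sumEFin.
  apply: is_cvg_nneseries => n _ _; exact: normr_ge0.
have mg : measurable_fun [set: T] g.
  apply: (emeasurable_fun_cvg (fun n => EFin \o G n)).
    by move=> n; exact/measurable_EFinP.
  by move=> x _; exact: Gg.
have gN : ('N[mu]_p[g] <= 2%:E)%E.
  apply: (Lnorm_fatou (f_ := fun n => EFin \o G n)) => //.
    by move=> n; exact/measurable_EFinP.
  by apply: nearW => x; exact: Gg.
have gfin := Lnorm_fin mg (le_lt_trans gN (ltry _)).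
have ucvg : \forall x \ae mu, cvgn (fun n => (u n : T -> R) x).
  apply: filterS gfin => x gx.
  pose d_ k := (u k.+1 : T -> R) x - (u k : T -> R) x.
  have : cvgn (series d_).
    apply: normed_cvg; apply/cvg_ex; exists (fine (g x)).
    have /fine_cvg : (EFin \o G ^~ x) @ \oo --> (fine (g x))%:E.
      by rewrite fineK//; exact: Gg.
    rewrite (_ : fine \o _ = [normed series d_])//; apply/funext => n.
    by rewrite /= /G /series/= big_mkord.
  move=> dcvg; have -> : (fun n => (u n : T -> R) x) =
      (fun n => (u 0%N : T -> R) x + series d_ n).
    apply/funext => n; rewrite /series/= telescope_sumr//.
    by rewrite addrC subrK.
  exact: is_cvgD (is_cvg_cst _) dcvg.
pose f x : R := fine (limn_esup (fun n => ((u n : T -> R) x)%:E)).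
have mf : measurable_fun [set: T] f.
  apply: (measurableT_comp (@fine_measurable _ _ _)) => //.
  by apply: measurable_fun_limn_esup => n; exact/measurable_EFinP.
have uf : \forall x \ae mu, (fun n => (u n : T -> R) x) @ \oo --> f x.
  apply: filterS ucvg => x /cvg_ex[l ul].
  suff -> : f x = l by [].
  rewrite /f; have /cvg_limn_einf_sup[_ ->] // : (fun n => ((u n : T -> R) x)%:E) @ \oo --> l%:E.
  by apply: cvg_EFin => //; exact: nearW.
have fN n : ('N[mu]_p[EFin \o (fun x => f x - (u n : T -> R) x)%R] <= (2 * 2^-1 ^+ n)%:E)%E.
  apply: (Lnorm_fatou (f_ := fun m => EFin \o (fun x => (u (n + m)%N : T -> R) x - (u n : T -> R) x))).
  - by move=> m; apply/measurable_EFinP; exact: measurable_funB.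
  - by apply/measurable_EFinP; exact: measurable_funB.
  - move=> m; have := uB n m; rewrite -lee_fin => /(le_trans _); apply.
    rewrite [leRHS]Lspace_normE; apply: ae_le_Lnorm => //.
    + exact: measurable_funB.
    + exact: Lspace_measurable.
    + by apply: filterS (LspaceBE (u (n + m)%N) (u n)) => x ->.
  - apply: filterS uf => x ux /=.
    apply: cvg_EFin; first exact: nearW.
    apply: cvgB; last exact: cvg_cst.
    by move: ux; rewrite -(cvg_shiftn n); under eq_fun do rewrite addnC.
have fL : f \in Lfun mu p.
  have : (fun x => f x - (u 0%N : T -> R) x) \in Lfun mu p.
    apply/andP; split; rewrite inE//=; first exact: measurable_funB.
    exact: (le_lt_trans (fN 0%N) (ltry _)).
  have [_ LD] := Lfun_addr_closed mu p1.
  move=> h; have /= := LD _ _ h (Lspace_Lfun (u 0%N)).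
  by rewrite [X in X \in _](_ : _ = f)//; apply/funext => x; rewrite /= subrK.
exists (Lspace_mk p1 fL) => n; rewrite -lee_fin [leLHS]Lspace_normE.
apply: le_trans (fN n); apply: ae_le_Lnorm => //.
- exact: Lspace_measurable.
- exact: measurable_funB.
- apply: filterS (filterI (LspaceBE (Lspace_mk p1 fL) (u n)) (Lspace_mkE p1 fL)).
  by move=> x /= [-> ->].
Qed.

Let Lspace_cauchy_cvg (F : set_system L) : ProperFilter F -> cauchy F -> cvg F.
Proof.
move=> FF /cauchyP Fc.
have e0 n : 0 < 2^-1 ^+ n.+2 :> R by rewrite exprn_gt0// invr_gt0.
have /choice[u uF] : forall n, exists x : L, F (ball x (2^-1 ^+ n.+2)).
  by move=> n; exact: Fc.
have uc n : `|u n.+1 - u n| <= 2^-1 ^+ n.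
  have [y] := filter_ex (filterI (uF n.+1) (uF n)).
  rewrite -!ball_normE/= => -[y1 y2].
  rewrite -(subrKA y) (le_trans (ler_normD _ _))// (distrC y).
  rewrite (le_trans (lerD (ltW y1) (ltW y2)))// !exprS.
  have : 0 <= 2^-1 ^+ n :> R by rewrite exprn_ge0// invr_ge0.
  by move: (_ ^+ n) => a a0; lra.
have [f fu] := fast_cauchy uc.
apply/cvg_ex; exists f; apply/cvgrPdist_lt => e e_gt0.
have : geometric 3 (2^-1 : R) @ \oo --> (0 : R).
  by apply: cvg_geometric; rewrite ger0_norm ?invr_ge0// invf_lt1// ltr1n.
move=> /cvgrPdist_lt /(_ e e_gt0)[N _ /(_ N (leqnn _))] /=.
rewrite sub0r normrN ger0_norm ?mulr_ge0 ?exprn_ge0 ?invr_ge0// => Ne.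
apply: filterS (uF N) => y; rewrite -ball_normE/= => uy.
rewrite -(subrKA (u N)) (le_lt_trans (ler_normD _ _))//.
apply: le_lt_trans Ne; apply: le_trans (lerD (fu N) (ltW uy)) _.
rewrite !exprS; have : 0 <= 2^-1 ^+ N :> R by rewrite exprn_ge0// invr_ge0.
by move: (_ ^+ N) => a a0; lra.
Qed.

HB.instance Definition _ := Uniform_isComplete.Build L Lspace_cauchy_cvg.

Let Lspace_le (u v : L) : Prop :=
  \forall x \ae mu, (u : T -> R) x <= (v : T -> R) x.

Let le_refl u : Lspace_le u u.
Proof. exact: nearW. Qed.

Let le_anti u v : Lspace_le u v -> Lspace_le v u -> u = v.
Proof.
move=> uv vu; apply: Lspace_inj; apply: filterS (filterI uv vu) => x /= [h1 h2].
by apply/eqP; rewrite eq_le h1.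
Qed.

Let le_trans' v u w : Lspace_le u v -> Lspace_le v w -> Lspace_le u w.
Proof.
move=> uv vw; apply: filterS (filterI uv vw) => x /= [h1 h2].
exact: le_trans h1 h2.
Qed.

Let supP (u v w : L) :
  Lspace_le (Lspace_sup u v) w <-> Lspace_le u w /\ Lspace_le v w.
Proof.
have E := Lspace_mkE p1 (Lfun_max u v); split.
  by move=> h; split; apply: filterS (filterI E h) => x /= [->];
    rewrite ge_max => /andP[].
move=> [h1 h2]; apply: filterS (filterI E (filterI h1 h2)) => x /= [-> [a b]].
by rewrite ge_max a b.
Qed.

Let infP (u v w : L) :
  Lspace_le w (Lspace_inf u v) <-> Lspace_le w u /\ Lspace_le w v.
Proof.
have E := Lspace_mkE p1 (Lfun_min u v); split.
  by move=> h; split; apply: filterS (filterI E h) => x /= [->];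
    rewrite le_min => /andP[].
move=> [h1 h2]; apply: filterS (filterI E (filterI h1 h2)) => x /= [-> [a b]].
by rewrite le_min a b.
Qed.

Let leD2r (w u v : L) : Lspace_le u v -> Lspace_le (u + w) (v + w).
Proof.
move=> uv.
apply: filterS (filterI uv (filterI (LspaceDE u w) (LspaceDE v w))) => x /=.
by move=> [h [-> ->]]; rewrite lerD2r.
Qed.

Let scale_ge0 (a : R) (u : L) :
  0 <= a -> Lspace_le 0 u -> Lspace_le 0 (a *: u).
Proof.
move=> a0 u0.
apply: filterS (filterI u0 (filterI (Lspace0E mu p1) (LspaceZE a u))) => x.
by move=> [h [e1 e2]]; rewrite e1 e2 in h *; exact: mulr_ge0.
Qed.

Let le_norm (u v : L) :
  Lspace_le (Lspace_sup u (- u)) (Lspace_sup v (- v)) -> `|u| <= `|v|.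
Proof.
move=> uv; apply: ae_le_Lspace_norm.
have E (w : L) : \forall x \ae mu,
    (Lspace_sup w (- w) : T -> R) x = `|(w : T -> R) x|.
  apply: filterS (filterI (Lspace_mkE p1 (Lfun_max w (- w))) (LspaceNE w)).
  by move=> x [-> ->]; rewrite maxrN.
apply: filterS (filterI uv (filterI (E u) (E v))) => x /= [h [e1 e2]].
by rewrite -e1 -e2.
Qed.

HB.instance Definition _ := CompleteNormedModule_isBanachLattice.Build R L
  le_refl le_anti le_trans' supP infP leD2r scale_ge0 le_norm.

Lemma Lspace_normrE (u : L) :
  `|u|%:E = ('N[mu]_p[EFin \o (u : T -> R)])%E.
Proof. exact: Lspace_normE. Qed.

Lemma Lspace_leE (u v : L) :
  (u <=L v) = (\forall x \ae mu, (u : T -> R) x <= (v : T -> R) x).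
Proof. by []. Qed.

End Lspace_complete.

Section operators.
Context (R : realType) (X Y : normedModType R).

Definition bounded_operator (T : {linear X -> Y}) : Prop :=
  exists M : R, forall x, `|T x| <= M * `|x|.

(* Meaningful for bounded operators only: sup is 0 on unbounded sets. *)
Definition opnorm (T : {linear X -> Y}) : R :=
  sup [set `|T x| | x in [set x | `|x| <= 1]].

(* The unit sphere of L(X, Y). *)
Definition operator_sphere : set {linear X -> Y} :=
  [set T | bounded_operator T /\ opnorm T = 1].

End operators.

Definition positive_operator (R : realType) (X Y : banachLatticeType R)
    (T : {linear X -> Y}) : Prop :=
  forall x, 0 <=L x -> 0 <=L T x.

Definition BPBp_positive (R : realType) (X Y : banachLatticeType R) : Prop :=
  forall eps : R, 0 < eps < 1 ->
  exists eta : R, 0 < eta < eps /\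
    forall S : {linear X -> Y}, operator_sphere S -> positive_operator S ->
    forall x0 : X, `|x0| = 1 -> `|S x0| > 1 - eta ->
    exists (u0 : X) (T : {linear X -> Y}),
      [/\ `|u0| = 1, operator_sphere T & positive_operator T] /\
      [/\ `|T u0| = 1, `|u0 - x0| < eps & opnorm (T \- S) < eps].

Definition Linfty d (T : measurableType d) (R : realType)
  (mu : {measure set T -> \bar R}) := LspaceType mu (leey 1%E).

Definition L1 d (T : measurableType d) (R : realType)
  (mu : {measure set T -> \bar R}) := LspaceType mu (lexx 1%E).

(* Main.v *)
(** A positive operator on L_oo attains its norm at the constant function 1.
Let r = eps / 2 and let A, B be the sets where f0 > 1 - r, resp. f0 < -(1 - r).
Replacing f0 by 1 on A and by -1 on B gives f1.  If |S f0| is close to 1, then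
S is small on the complement of A and B, and g = S 1_A, h = S 1_B are nearly
disjoint, since |g + h| - |g - h| = 2 |min(g, h)|.  With D the set where h <= g,
the positive operator T0 f = 1_D S(1_A f) + 1_(~D) S(1_B f) is dominated by S
and makes the images of 1_A and 1_B disjoint, so that |T0 f1| = |T0 1|; then
T = T0 / |T0 1| is the required operator. *)
Require Import Defs.
From mathcomp Require Import all_boot all_order all_algebra.
From mathcomp Require Import all_classical all_reals all_analysis.
From HB Require Import structures.
From mathcomp Require Import measurable_realfun ess_sup_inf ring lra.

Set Implicit Arguments.
Unset Strict Implicit.
Unset Printing Implicit Defensive.

Import Order.TTheory GRing.Theory Num.Theory.
Import numFieldNormedType.Exports.

Local Open Scope classical_set_scope.
Local Open Scope ring_scope.

(** * Restriction to a measurable set as a linear operator *)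

Section Lspace_restriction.
Context {d} {T : measurableType d} {R : realType}.
Context {mu : {measure set T -> \bar R}} {p : \bar R} {p1 : (1 <= p)%E}.
Local Notation L := (LspaceType mu p1).
Context {E : set T} (mE : measurable E).

Lemma Lfun_indicM (u : L) : (fun x => \1_E x * (u : T -> R) x) \in Lfun mu p.
Proof.
apply: (ae_le_Lfun p1 _ (Lspace_Lfun u)).
  by apply: measurable_funM; [exact: measurable_indic|exact: Lspace_measurable].
apply: nearW => x; rewrite indicE normrM.
by case: (x \in E); rewrite ?normr1 ?mul1r// normr0 mul0r.
Qed.

Definition Lspace_restrict (u : L) : L := Lspace_mk p1 (Lfun_indicM u).

Lemma Lspace_restrictE (u : L) :
  \forall x \ae mu, (Lspace_restrict u : T -> R) x = \1_E x * (u : T -> R) x.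
Proof. exact: Lspace_mkE. Qed.

Lemma Lspace_restrict_is_linear : linear Lspace_restrict.
Proof.
move=> a u v; apply: Lspace_inj.
have H1 := Lspace_restrictE (a *: u + v).
have H2 := LspaceDE (a *: u) v.
have H3 := LspaceZE a u.
have H4 := LspaceDE (a *: Lspace_restrict u) (Lspace_restrict v).
have H5 := LspaceZE a (Lspace_restrict u).
have H6 := Lspace_restrictE u.
have H7 := Lspace_restrictE v.
apply: filterS (filterI (filterI H1 (filterI H2 H3)) (filterI (filterI H4 H5) (filterI H6 H7))).
by move=> x /= [[-> [-> ->]] [[-> ->] [-> ->]]]; ring.
Qed.

HB.instance Definition _ :=
  GRing.isLinear.Build R L L *:%R Lspace_restrict Lspace_restrict_is_linear.

End Lspace_restriction.

(** The class [0] has a representative that vanishes only almost everywhere, so passing between the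
    order and pointwise signs costs a null set. *)
Lemma Lspace_ge0P {d} {T : measurableType d} {R : realType}
    {mu : {measure set T -> \bar R}} {p : \bar R} {p1 : (1 <= p)%E}
    (u : LspaceType mu p1) :
  0 <=L u <-> \forall x \ae mu, 0 <= (u : T -> R) x.
Proof.
split=> u0; apply: filterS (filterI u0 (Lspace0E mu p1)) => x /= [le0 E0].
  by apply: le_trans le0; rewrite [X in _ <= X]E0.
by rewrite [X in X <= _]E0.
Qed.

Lemma Lspace_addr_ge0 {d} {T : measurableType d} {R : realType}
    {mu : {measure set T -> \bar R}} {p : \bar R} {p1 : (1 <= p)%E}
    (u v : LspaceType mu p1) : 0 <=L u -> 0 <=L v -> 0 <=L u + v.
Proof.
move=> /Lspace_ge0P u0 /Lspace_ge0P v0; apply/Lspace_ge0P.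
by apply: filterS (filterI (LspaceDE u v) (filterI u0 v0)) => x /= [-> []]; exact: addr_ge0.
Qed.

(** * The norms of L_oo and L_1 read on representatives *)

Section Lspace_norm_theory.
Context {d} {T : measurableType d} {R : realType} {mu : {measure set T -> \bar R}}.

Lemma Linfty_le_norm (u : Linfty mu) : \forall x \ae mu, `|(u : T -> R) x| <= `|u|.
Proof.
have := Lspace_normrE u; rewrite unlock; case: ifPn => [_ E|].
  have := ess_sup_ge mu (abse \o (EFin \o (u : T -> R))).
  by apply: filterS => x /=; rewrite -E lee_fin.
(* When the whole space is null the norm is 0 by convention, and the whole space serves as
   exceptional set. *)
rewrite -leNgt => mu0 _; exists [set: T]; split => //.
by apply/eqP; rewrite eq_le mu0 measure_ge0.
Qed.

Lemma Linfty_norm_le (u : Linfty mu) (c : R) : 0 <= c ->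
  (\forall x \ae mu, `|(u : T -> R) x| <= c) -> `|u| <= c.
Proof.
move=> c0 uc; rewrite -lee_fin Lspace_normrE unlock; case: ifPn => // _.
by apply/ess_supP; apply: filterS uc => x /=; rewrite lee_fin.
Qed.

(** The integral is additive on nonnegative functions. Every L_1 norm identity below is thereby
    reduced to a pointwise one. *)
Lemma L1_norm_add (u v w : L1 mu) :
  (\forall x \ae mu, `|(w : T -> R) x| = `|(u : T -> R) x| + `|(v : T -> R) x|) ->
  `|w| = `|u| + `|v|.
Proof.
move=> wE; apply: EFin_inj; rewrite EFinD !Lspace_normrE !Lnorm1.
have m (z : L1 mu) : measurable_fun [set: T] (fun x => `|(EFin \o (z : T -> R)) x|%E).
  by apply: measurableT_comp => //; apply/measurable_EFinP; exact: Lspace_measurable.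
rewrite -ge0_integralD//; apply: ge0_ae_eq_integral => //.
- exact: emeasurable_funD.
- by move=> x _; exact: adde_ge0.
- by apply: filterS wE => x /= xE _; rewrite xE EFinD.
Qed.

Lemma Lfun_cst1 : (cst 1 : T -> R) \in Lfun mu +oo%E.
Proof.
apply/andP; split; rewrite inE/=; first exact: measurable_cst.
rewrite /finite_norm unlock; case: ifPn => // _.
apply: (@le_lt_trans _ _ 1%E) (ltry _).
by apply/ess_supP; apply: nearW => x /=; rewrite normr1.
Qed.

Definition Linfty_one : Linfty mu := Lspace_mk (leey 1%E) Lfun_cst1.

Lemma Linfty_oneE : \forall x \ae mu, (Linfty_one : T -> R) x = 1.
Proof. exact: Lspace_mkE. Qed.

(** Only an inequality: for the zero measure this norm is 0. *)
Lemma Linfty_norm_one_le : `|Linfty_one| <= 1.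
Proof. by apply: Linfty_norm_le => //; apply: filterS Linfty_oneE => x ->; rewrite normr1. Qed.

End Lspace_norm_theory.

Arguments Linfty_one {d T R} mu.

(** * Monotonicity and norms of positive operators *)

Section positive_operator_theory.
Context {R : realType} {d1 d2 : measure_display}.
Context {T1 : measurableType d1} {T2 : measurableType d2}.
Context {mu : {measure set T1 -> \bar R}} {nu : {measure set T2 -> \bar R}}.
Context {p q : \bar R} {p1 : (1 <= p)%E} {q1 : (1 <= q)%E}.

Lemma positive_operator_le (S : {linear LspaceType mu p1 -> LspaceType nu q1}) f g :
  positive_operator S -> f <=L g -> S f <=L S g.
Proof.
move=> S0 fg; have /Lspace_ge0P : 0 <=L S (g - f).
  apply: S0; apply/Lspace_ge0P.
  apply: filterS (filterI fg (LspaceBE g f)) => x /=.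
  by move=> [le_fg ->]; rewrite subr_ge0.
rewrite linearB Lspace_leE => h.
apply: filterS (filterI h (LspaceBE (S g) (S f))) => x /=.
by move=> [S_ge0 E]; rewrite -subr_ge0 -E.
Qed.

(** Both [f] and [- f] lie below [g], and [S] is monotone. *)
Lemma positive_operator_abs_le (S : {linear LspaceType mu p1 -> LspaceType nu q1})
    (f g : LspaceType mu p1) : positive_operator S ->
  (\forall x \ae mu, `|(f : T1 -> R) x| <= (g : T1 -> R) x) ->
  \forall x \ae nu, `|(S f : T2 -> R) x| <= (S g : T2 -> R) x.
Proof.
move=> S0 fg.
have : S f <=L S g.
  apply: positive_operator_le => //; rewrite Lspace_leE.
  by apply: filterS fg => x; apply: le_trans; exact: ler_norm.
have : S (- f) <=L S g.
  apply: positive_operator_le => //; rewrite Lspace_leE.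
  apply: filterS (filterI fg (LspaceNE f)) => x [+ ->].
  by apply: le_trans; rewrite -normrN; exact: ler_norm.
rewrite linearN !Lspace_leE => h1 h2.
apply: filterS (filterI h1 (filterI h2 (LspaceNE (S f)))) => x [+ [+ E]].
by rewrite E ler_norml => ? ->; rewrite andbT lerNl.
Qed.

End positive_operator_theory.

Section opnorm_theory.
Context {R : realType} {X Y : normedModType R}.

Lemma opnorm_le (T : {linear X -> Y}) (c : R) :
  (forall x, `|x| <= 1 -> `|T x| <= c) -> opnorm T <= c.
Proof.
move=> Tc; apply: ge_sup; first by exists `|T 0|, 0 => //=; rewrite normr0.
by move=> _ [x /= x1 <-]; exact: Tc.
Qed.

Lemma le_opnorm (T : {linear X -> Y}) (x : X) : bounded_operator T ->
  `|x| <= 1 -> `|T x| <= opnorm T.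
Proof.
move=> [M TM] x1; apply: ub_le_sup; last by exists x.
(* Nothing in [bounded_operator] forces [M] to be nonnegative, hence the absolute value. *)
exists `|M| => _ [y /= y1 <-]; apply: le_trans (TM y) _.
by rewrite (le_trans (ler_norm _))// normrM normr_id ler_piMr.
Qed.

End opnorm_theory.

Section positive_operator_Linfty.
Context {R : realType} {d1 d2 : measure_display}.
Context {T1 : measurableType d1} {T2 : measurableType d2}.
Context {mu : {measure set T1 -> \bar R}} {nu : {measure set T2 -> \bar R}}.
Context {q : \bar R} {q1 : (1 <= q)%E}.
Variables (S : {linear Linfty mu -> LspaceType nu q1}) (S0 : positive_operator S).

(** Almost everywhere [f] is dominated in absolute value by the constant function of value [|f|],
    and [S] preserves this domination. *)
Lemma positive_operator_norm_le f : `|S f| <= `|S (Linfty_one mu)| * `|f|.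
Proof.
have -> : `|S (Linfty_one mu)| * `|f| = `|S (`|f| *: Linfty_one mu)|.
  by rewrite linearZ normrZ normr_id mulrC.
apply: ae_le_Lspace_norm.
have : \forall x \ae nu,
    `|(S f : T2 -> R) x| <= (S (`|f| *: Linfty_one mu) : T2 -> R) x.
  apply: positive_operator_abs_le => //.
  have H := LspaceZE `|f| (Linfty_one mu).
  apply: filterS (filterI (Linfty_le_norm f) (filterI H Linfty_oneE)) => x /=.
  by move=> [? [-> ->]]; rewrite mulr1.
by apply: filterS => x /le_trans; apply; exact: ler_norm.
Qed.

Lemma positive_operator_bounded : bounded_operator S.
Proof. exists `|S (Linfty_one mu)|; exact: positive_operator_norm_le. Qed.

Lemma positive_operator_opnorm : opnorm S = `|S (Linfty_one mu)|.
Proof.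
apply/eqP; rewrite eq_le; apply/andP; split.
  apply: opnorm_le => f f1; apply: le_trans (positive_operator_norm_le f) _.
  by rewrite ler_piMr.
by apply: le_opnorm; [exact: positive_operator_bounded|exact: Linfty_norm_one_le].
Qed.

End positive_operator_Linfty.

(** * Cutting a positive operator and rescaling the result *)

Section cut_operator.
Context {R : realType} {d1 d2 : measure_display}.
Context {T1 : measurableType d1} {T2 : measurableType d2}.
Context {mu : {measure set T1 -> \bar R}} {nu : {measure set T2 -> \bar R}}.
Context {p q : \bar R} {p1 : (1 <= p)%E} {q1 : (1 <= q)%E}.
Local Notation X := (LspaceType mu p1).
Local Notation Y := (LspaceType nu q1).
Variables (S : {linear X -> Y}) (S0 : positive_operator S).
Variables (A B : set T1) (D : set T2).
Variables (mA : measurable A) (mB : measurable B) (mD : measurable D).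

Lemma Lspace_restrict_ge0 (E : set T1) (mE : measurable E) (f : X) :
  0 <=L f -> 0 <=L Lspace_restrict mE f.
Proof.
move=> /Lspace_ge0P f0; apply/Lspace_ge0P.
apply: filterS (filterI f0 (Lspace_restrictE mE f)) => x /= [? ->].
by rewrite indicE mulr_ge0.
Qed.

Lemma Lspace_restrict_le (E : set T1) (mE : measurable E) (f : X) :
  0 <=L f -> Lspace_restrict mE f <=L f.
Proof.
move=> /Lspace_ge0P f0; rewrite Lspace_leE.
apply: filterS (filterI f0 (Lspace_restrictE mE f)) => x /= [? ->].
by rewrite indicE; case: (x \in E); rewrite ?mul1r ?mul0r.
Qed.

(** For [f] positive both branches lie between 0 and [S f], because restriction decreases [f] and
    [S] is monotone. Hence [T] and [S \- T] are both positive. *)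
Lemma exists_cut_operator : exists T : {linear X -> Y},
  [/\ positive_operator T, positive_operator (S \- T) &
    forall f, \forall y \ae nu, (T f : T2 -> R) y =
      if y \in D then (S (Lspace_restrict mA f) : T2 -> R) y
      else (S (Lspace_restrict mB f) : T2 -> R) y].
Proof.
pose T : {linear X -> Y} := (Lspace_restrict mD \o (S \o Lspace_restrict mA)) \+
  (Lspace_restrict (measurableC mD) \o (S \o Lspace_restrict mB)).
have TE f : \forall y \ae nu, (T f : T2 -> R) y =
    if y \in D then (S (Lspace_restrict mA f) : T2 -> R) y
    else (S (Lspace_restrict mB f) : T2 -> R) y.
  have H1 := Lspace_restrictE mD (S (Lspace_restrict mA f)).
  have H2 := Lspace_restrictE (measurableC mD) (S (Lspace_restrict mB f)).
  have H3 := LspaceDE (Lspace_restrict mD (S (Lspace_restrict mA f)))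
    (Lspace_restrict (measurableC mD) (S (Lspace_restrict mB f))).
  apply: filterS (filterI H1 (filterI H2 H3)) => y /= [E1 [E2 E3]].
  rewrite E3 E1 E2 !indicE in_setC; case: (y \in D) => /=.
    by rewrite mul1r mul0r addr0.
  by rewrite mul1r mul0r add0r.
exists T; split=> // f f0; apply/Lspace_ge0P.
  have /Lspace_ge0P HA := S0 (Lspace_restrict_ge0 mA f0).
  have /Lspace_ge0P HB := S0 (Lspace_restrict_ge0 mB f0).
  by apply: filterS (filterI (TE f) (filterI HA HB)) => y [-> [? ?]]; case: ifP.
have := positive_operator_le S0 (Lspace_restrict_le mA f0).
have := positive_operator_le S0 (Lspace_restrict_le mB f0).
rewrite !Lspace_leE => HB HA.
have H := LspaceBE (S f) (T f).
apply: filterS (filterI (filterI H (TE f)) (filterI HA HB)) => y.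
by move=> [[E cE] [? ?]]; rewrite [X in 0 <= X]E cE subr_ge0; case: ifP.
Qed.

End cut_operator.

(** With t the norm of T 1, split T f / t - S f as (1/t - 1) T f + (T f - S f). On the unit ball the
    first term is at most (1/t - 1) t = 1 - t, and the second is controlled at 1 since [S \- T] is
    positive. *)
Lemma opnorm_rescale_sub_le {R : realType} {d1 d2 : measure_display}
    {T1 : measurableType d1} {T2 : measurableType d2}
    {mu : {measure set T1 -> \bar R}} {nu : {measure set T2 -> \bar R}}
    {q : \bar R} {q1 : (1 <= q)%E} (S T : {linear Linfty mu -> LspaceType nu q1}) :
  positive_operator T -> positive_operator (S \- T) ->
  0 < `|T (Linfty_one mu)| <= 1 ->
  opnorm ((`|T (Linfty_one mu)|^-1 \*: T) \- S) <=
  1 - `|T (Linfty_one mu)| + `|S (Linfty_one mu) - T (Linfty_one mu)|.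
Proof.
move=> T0 ST0; set t := `|T _| => /andP[t0 t1]; apply: opnorm_le => f f1 /=.
rewrite -(subrKA (T f)) (le_trans (ler_normD _ _))// lerD//.
  rewrite -[X in _ - X]scale1r -scalerBl normrZ ger0_norm; last first.
    by rewrite subr_ge0 invf_ge1.
  have Tf : `|T f| <= t.
    by apply: le_trans (positive_operator_norm_le T0 f) _; rewrite ler_piMr.
  apply: le_trans (ler_wpM2l _ Tf) _; first by rewrite subr_ge0 invf_ge1.
  by rewrite mulrBl mulVf ?gt_eqF// mul1r.
rewrite distrC; have /= := positive_operator_norm_le ST0 f.
by move=> /le_trans; apply; rewrite ler_piMr.
Qed.

(** * Perturbing the point of L_oo *)

Section Linfty_peak.
Context {R : realType} {d : measure_display} {T : measurableType d}.
Context {mu : {measure set T -> \bar R}}.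
Local Notation e := (Linfty_one mu).

(* [A], [B] are the sets [f > 1 - r], [f < - (1 - r)], and [chi] is the indicator
   of the complement of their union. *)
Lemma Linfty_peak (f : Linfty mu) (r : R) : `|f| = 1 -> 0 < r < 2^-1 ->
  exists (A B : set T) (mA : measurable A) (mB : measurable B) (f1 : Linfty mu),
    let MA : Linfty mu -> Linfty mu := Lspace_restrict mA in
    let MB : Linfty mu -> Linfty mu := Lspace_restrict mB in
    let chi := e - MA e - MB e in
    [/\ `|f1| <= 1, `|f1 - f| <= r, 0 <=L f -> 0 <=L f1, MA f1 = MA e
      & MB f1 = - MB e] /\
    [/\ 0 <=L chi,
      \forall x \ae mu, `|(f : T -> R) x| <= ((e - r *: chi : Linfty mu) : T -> R) x
    & \forall x \ae mu, `|((f - (MA e - MB e) : Linfty mu) : T -> R) x| <=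
        ((r *: e + chi : Linfty mu) : T -> R) x].
Proof.
move=> f1_norm /andP[r0 r1].
have eE : \forall x \ae mu, (e : T -> R) x = 1 := Linfty_oneE.
pose A := [set x | 1 - r < (f : T -> R) x].
pose B := [set x | (f : T -> R) x < - (1 - r)].
have mf := Lspace_measurable f.
have mA : measurable A.
  rewrite (_ : A = ~` [set x | (f : T -> R) x <= 1 - r]); last first.
    by apply/seteqP; split=> x /=; rewrite /A/= ltNge => /negP.
  by apply: measurableC; rewrite -[X in measurable X]setTI; exact: measurable_fun_le.
have mB : measurable B.
  rewrite (_ : B = ~` [set x | - (1 - r) <= (f : T -> R) x]); last first.
    by apply/seteqP; split=> x /=; rewrite /B/= ltNge => /negP.
  by apply: measurableC; rewrite -[X in measurable X]setTI; exact: measurable_fun_le.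
pose MA : Linfty mu -> Linfty mu := Lspace_restrict mA.
pose MB : Linfty mu -> Linfty mu := Lspace_restrict mB.
have MAE u : \forall x \ae mu, (MA u : T -> R) x =
    if 1 - r < (f : T -> R) x then (u : T -> R) x else 0.
  apply: filterS (Lspace_restrictE mA u) => x ->; rewrite indicE.
  case: ifPn => xA; first by rewrite mem_set ?mul1r.
  by rewrite memNset ?mul0r// => /(negP xA).
have MBE u : \forall x \ae mu, (MB u : T -> R) x =
    if (f : T -> R) x < - (1 - r) then (u : T -> R) x else 0.
  apply: filterS (Lspace_restrictE mB u) => x ->; rewrite indicE.
  case: ifPn => xB; first by rewrite mem_set ?mul1r.
  by rewrite memNset ?mul0r// => /(negP xB).
(* The sets [A] and [B] are disjoint since r < 1, so this difference is an indicator; in this form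
   linear operators split over it. *)
pose chi : Linfty mu := e - MA e - MB e.
have chiE : \forall x \ae mu, (chi : T -> R) x =
    if 1 - r < (f : T -> R) x then 0
    else if (f : T -> R) x < - (1 - r) then 0 else 1.
  have H1 := LspaceBE (e - MA e) (MB e); have H2 := LspaceBE e (MA e).
  have H3 := MAE e; have H4 := MBE e.
  apply: filterS (filterI (filterI H1 H2) (filterI (filterI H3 H4) eE)) => x.
  move=> [[-> ->] [[-> ->] ->]]; move: (f x) => a.
  by case: ltP => ?; case: ltP => ?; lra.
pose f1 : Linfty mu := MA e - MB e + (f - MA f - MB f).
have f1E : \forall x \ae mu, (f1 : T -> R) x =
    if 1 - r < (f : T -> R) x then 1
    else if (f : T -> R) x < - (1 - r) then -1 else (f : T -> R) x.
  have H1 := LspaceDE (MA e - MB e) (f - MA f - MB f).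
  have H2 := LspaceBE (MA e) (MB e); have H3 := LspaceBE (f - MA f) (MB f).
  have H4 := LspaceBE f (MA f); have H5 := MAE e; have H6 := MBE e.
  have H7 := MAE f; have H8 := MBE f.
  apply: filterS (filterI (filterI (filterI H1 H2) (filterI H3 H4))
    (filterI (filterI (filterI H5 H6) (filterI H7 H8)) eE)) => x.
  move=> [[[-> ->] [-> ->]] [[[-> ->] [-> ->]] ->]]; move: (f x) => a.
  by case: ltP => ?; case: ltP => ?; lra.
have f_le : \forall x \ae mu, `|(f : T -> R) x| <= 1.
  by have := Linfty_le_norm f; rewrite f1_norm.
exists A, B, mA, mB, f1; rewrite -/MA -/MB -/chi; split; split.
- apply: Linfty_norm_le => //; apply: filterS (filterI f1E f_le) => x [-> ?].
  by case: ifP => _; [rewrite normr1|case: ifP => // _; rewrite normrN1].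
(* [f1] differs from [f] only on [A] and [B], where [f] is within r of 1, resp. -1. *)
- apply: Linfty_norm_le; first exact: ltW.
  apply: filterS (filterI (LspaceBE f1 f) (filterI f1E f_le)) => x [-> [->]].
  move: (f x) => a; rewrite !ler_norml => /andP[? ?].
  by case: ltP => ?; [|case: ltP => ?]; apply/andP; split; lra.
- move=> /Lspace_ge0P f_ge0; apply/Lspace_ge0P.
  apply: filterS (filterI f1E f_ge0) => x /= [->]; move: (f x) => a ?.
  by case: ltP => // ?; case: ltP => // ?; lra.
- apply: Lspace_inj; have H1 := MAE f1; have H2 := MAE e.
  apply: filterS (filterI (filterI H1 H2) (filterI f1E eE)) => x.
  by move=> [[-> ->] [-> ->]]; case: ifP => // ->.
- apply: Lspace_inj.
  have H1 := MBE f1; have H2 := MBE e; have H3 := LspaceNE (MB e).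
  apply: filterS (filterI (filterI H1 H2) (filterI (filterI f1E eE) H3)) => x.
  move=> [[-> E] [[-> E'] ->]]; rewrite E E'; move: (f x) => a.
  by case: (ltP a) => ?; [case: ltP => ?|]; lra.
- apply/Lspace_ge0P; apply: filterS chiE => x ->.
  by case: ifP => // _; case: ifP.
(* Where [chi] is 0 this is |f| <= 1; elsewhere |f| <= 1 - r by the choice of [A] and [B]. *)
- have H1 := LspaceBE e (r *: chi); have H2 := LspaceZE r chi.
  apply: filterS (filterI (filterI (filterI H1 H2) (filterI eE chiE)) f_le) => x.
  move=> [[[-> ->] [-> ->]]]; move: (f x) => a; rewrite !ler_norml => /andP[? ?].
  by case: ltP => ?; [|case: ltP => ?]; apply/andP; split; lra.
(* On [A] and [B] the difference is at most r; elsewhere it is [f] itself, bounded by 1. *)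
- have H1 := LspaceBE f (MA e - MB e); have H2 := LspaceBE (MA e) (MB e).
  have H3 := MAE e; have H4 := MBE e.
  have H5 := LspaceDE (r *: e) chi; have H6 := LspaceZE r e.
  apply: filterS (filterI (filterI (filterI H1 H2) (filterI H3 H4))
    (filterI (filterI (filterI H5 H6) (filterI eE chiE)) f_le)) => x.
  move=> [[[-> ->] [-> ->]] [[[-> ->] [-> ->]]]]; move: (f x) => a.
  rewrite !ler_norml => /andP[? ?].
  by case: ltP => ?; case: ltP => ?; apply/andP; split; lra.
Qed.

End Linfty_peak.

(** * Additivity of the L_1 norm on the positive cone *)

Section L1_max_min.
Context {R : realType} {d : measure_display} {T : measurableType d}.
Context {mu : {measure set T -> \bar R}}.
Implicit Types u v g h c s t : L1 mu.

Lemma L1_norm_addr_ge0 u v : 0 <=L u -> 0 <=L v -> `|u + v| = `|u| + `|v|.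
Proof.
move=> /Lspace_ge0P u0 /Lspace_ge0P v0; apply: L1_norm_add.
apply: filterS (filterI (filterI u0 v0) (LspaceDE u v)) => x [[? ?] ->].
by rewrite !ger0_norm ?addr_ge0.
Qed.

(** Pointwise a + b = |a - b| + 2 min(a, b) for a, b >= 0. It measures how far [g] and [h] are from
    being disjoint. *)
Lemma L1_norm_subr_inf g h : 0 <=L g -> 0 <=L h ->
  `|g| + `|h| = `|g - h| + 2 * `|Lspace_inf g h|.
Proof.
move=> g0 h0; rewrite -(L1_norm_addr_ge0 g0 h0).
have -> : 2 * `|Lspace_inf g h| = `|2 *: Lspace_inf g h|.
  by rewrite normrZ ger0_norm.
move: g0 h0 => /Lspace_ge0P g0 /Lspace_ge0P h0; apply: L1_norm_add.
have H1 := LspaceDE g h; have H2 := LspaceBE g h.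
have H3 := LspaceZE 2 (Lspace_inf g h).
have H4 := Lspace_mkE (lexx 1%E) (Lfun_min g h).
apply: filterS (filterI (filterI (filterI H1 H2) (filterI H3 H4)) (filterI g0 h0)) => x /=.
move=> [[[-> ->] [-> ->]]]; move: (g x) (h x) => a b [? ?].
rewrite [`|a + b|]ger0_norm ?addr_ge0//.
by case: (leP a b) => ?; [rewrite ler0_norm ?subr_le0//|rewrite gtr0_norm ?subr_gt0//];
  rewrite ger0_norm; lra.
Qed.

End L1_max_min.

(** * Construction of the new point and operator, with explicit constants *)

Lemma Linfty_L1_BPBp_positive {R : realType} {d1 d2 : measure_display}
    {T1 : measurableType d1} {T2 : measurableType d2}
    (mu : {measure set T1 -> \bar R}) (nu : {measure set T2 -> \bar R})
    (eps : R) (S : {linear Linfty mu -> L1 nu}) (f0 : Linfty mu) :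
  0 < eps < 1 -> operator_sphere S -> positive_operator S ->
  `|f0| = 1 -> `|S f0| > 1 - eps ^+ 2 / 16 ->
  exists (f1 : Linfty mu) (T : {linear Linfty mu -> L1 nu}),
    [/\ `|f1| = 1, operator_sphere T & positive_operator T] /\
    [/\ `|T f1| = 1, `|f1 - f0| < eps, opnorm (T \- S) < eps
      & 0 <=L f0 -> 0 <=L f1].
Proof.
move=> /andP[eps0 eps1] [_ S1] S0 f01 Sf0.
rewrite positive_operator_opnorm// in S1.
pose r := eps / 2.
have r0 : 0 < r by rewrite /r; lra.
have r1 : r < 2^-1 by rewrite /r; lra.
have := Linfty_peak f01 (introT andP (conj r0 r1)).
move=> [A [B [mA [mB [f1 /=]]]]].
set e := Linfty_one mu in S1 *.
set eA := Lspace_restrict mA e; set eB := Lspace_restrict mB e.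
set chi := e - eA - eB => -[[f1_le f1f0 f1_ge0 Af1 Bf1] [chi_ge0 f0_le_e f0_le_r]].
(* This splits [S e] into three positive pieces, whose L_1 norms add up to 1. *)
have eE : e = chi + eB + eA by rewrite /chi !subrK.
clearbody chi.
have e_ge0 : 0 <=L e by apply/Lspace_ge0P; apply: filterS Linfty_oneE => x ->.
have g_ge0 : 0 <=L S eA by apply: S0; exact: Lspace_restrict_ge0.
have h_ge0 : 0 <=L S eB by apply: S0; exact: Lspace_restrict_ge0.
have c_ge0 : 0 <=L S chi by exact: S0.
have SeE : S e = S chi + S eB + S eA by rewrite {1}eE !linearD.
have norm_Se : `|S e| = `|S chi| + (`|S eA| + `|S eB|).
  rewrite SeE -addrA [_ + S eA]addrC -L1_norm_addr_ge0// -L1_norm_addr_ge0//.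
  exact: Lspace_addr_ge0.
pose D := [set y | (S eB : T2 -> R) y <= (S eA : T2 -> R) y].
have mD : measurable D.
  by rewrite -[X in measurable X]setTI; apply: measurable_fun_le => //;
    exact: Lspace_measurable.
have inD y : (y \in D) = ((S eB : T2 -> R) y <= (S eA : T2 -> R) y).
  by apply/idP/idP; rewrite inE.
have [T0 [T0_pos ST0_pos T0E]] := exists_cut_operator S0 mA mB mD.
(* The two images agree on [D] and are opposite off [D], since [f1] is 1 on [A] and -1 on [B]. *)
have T0f1 : `|T0 f1| = `|T0 e|.
  have H1 := T0E f1; have H2 := T0E e.
  rewrite Af1 Bf1 linearN in H1; have H3 := LspaceNE (S eB).
  have absE : \forall y \ae nu, `|(T0 f1 : T2 -> R) y| = `|(T0 e : T2 -> R) y|.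
    apply: filterS (filterI H1 (filterI H2 H3)) => y [-> [-> ->]].
    by case: ifP; rewrite ?normrN.
  apply/eqP; rewrite eq_le; apply/andP; split; apply: ae_le_Lspace_norm;
    by apply: filterS absE => y ->.
(* By the choice of [D], [T0 e] is pointwise the larger of [S eA] and [S eB], so only [S chi] and
   the smaller one are lost. *)
have ST0e : S e - T0 e = S chi + Lspace_inf (S eA) (S eB).
  rewrite SeE; apply: Lspace_inj.
  have H1 := LspaceBE (S chi + S eB + S eA) (T0 e); have H2 := T0E e.
  have H3 := LspaceDE (S chi + S eB) (S eA); have H4 := LspaceDE (S chi) (S eB).
  have H5 := LspaceDE (S chi) (Lspace_inf (S eA) (S eB)).
  have H6 := Lspace_mkE (lexx 1%E) (Lfun_min (S eA) (S eB)).
  apply: filterS (filterI (filterI H1 H2) (filterI (filterI H3 H4) (filterI H5 H6))) => y.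
  move=> [[-> ->] [[-> ->] [-> ->]]]; rewrite inD -/eA -/eB.
  by move: (S eA y) (S eB y) (S chi y) => a b k; case: leP => ?; ring.
set w := Lspace_inf (S eA) (S eB) in ST0e.
have w_ge0 : 0 <=L w by exact/blatt_infP.
have norm_T0e : `|S e| = `|T0 e| + `|S e - T0 e|.
  rewrite -{1}(subrK (T0 e) (S e)) addrC L1_norm_addr_ge0//; first exact: T0_pos.
  exact: (ST0_pos _ e_ge0).
have norm_w := L1_norm_subr_inf g_ge0 h_ge0; rewrite -/w in norm_w.
have norm_ST0e : `|S e - T0 e| = `|S chi| + `|w| by rewrite ST0e L1_norm_addr_ge0.
have S_le (f g : Linfty mu) : (\forall x \ae mu, `|(f : T1 -> R) x| <= (g : T1 -> R) x) ->
    `|S f| <= `|S g|.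
  move=> /(positive_operator_abs_le S0) Sfg; apply: ae_le_Lspace_norm.
  by apply: filterS Sfg => y /le_trans; apply; exact: ler_norm.
(* [S f0] is dominated by S (e - r chi), whose norm is exactly the right-hand side by additivity on
   the positive cone. *)
have c_le : `|S f0| <= 1 - r * `|S chi|.
  apply: le_trans (S_le _ _ f0_le_e) _.
  have er_ge0 : 0 <=L S (e - r *: chi).
    apply: S0; apply/Lspace_ge0P; apply: filterS f0_le_e => x.
    exact: le_trans.
  have rc_ge0 : 0 <=L S (r *: chi).
    by apply: S0; apply: blatt_scale_ge0 => //; exact: ltW.
  have := L1_norm_addr_ge0 er_ge0 rc_ge0.
  by rewrite -linearD subrK S1 [in X in _ = _ + X]linearZ normrZ gtr0_norm//; lra.
(* The norm of [S eA - S eB] is 1 - |S chi| - 2 |w|, and replacing [f0] by [eA - eB] costs at most r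
   + |S chi|; the terms |S chi| cancel. *)
have w_le : `|S f0| <= 1 - 2 * `|w| + r.
  have Sr : `|S (f0 - (eA - eB))| <= r + `|S chi|.
    apply: le_trans (S_le _ _ f0_le_r) _.
    rewrite linearD linearZ (le_trans (ler_normD _ _))//.
    by rewrite normrZ gtr0_norm// S1 mulr1.
  have -> : S f0 = (S eA - S eB) + S (f0 - (eA - eB)).
    by rewrite -linearB -linearD addrC subrK.
  by apply: le_trans (ler_normD _ _) _; lra.
have c_lt : `|S chi| < eps / 8.
  rewrite -(ltr_pM2l r0); move: (lt_le_trans Sf0 c_le).
  by rewrite (_ : eps ^+ 2 / 16 = r * (eps / 8)) /r; lra.
have w_lt : 2 * `|w| < eps / 16 + r.
  have := lt_le_trans Sf0 w_le.
  have : eps ^+ 2 < eps by rewrite expr2 gtr_pMl.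
  by lra.
(* The total is below eps/4 + eps/16 + eps/2. The factor 2 is there because the loss enters the
   final estimate twice: as 1 - |T0 e| through rescaling, and as |S e - T0 e|. *)
have r_lt : 2 * `|S e - T0 e| < eps by rewrite norm_ST0e; move: w_lt; rewrite /r; lra.
have t0 : 0 < `|T0 e| by lra.
have t1 : `|T0 e| <= 1 by have := normr_ge0 (S e - T0 e); lra.
pose T : {linear Linfty mu -> L1 nu} := `|T0 e|^-1 \*: T0.
have T_pos : positive_operator T.
  by move=> f f_ge0; apply: blatt_scale_ge0; [rewrite invr_ge0|exact: T0_pos].
have Te : `|T e| = 1 by rewrite /T /= normrZ normfV normr_id mulVf ?gt_eqF.
have Tf1 : `|T f1| = 1.
  by rewrite /T /= normrZ normfV normr_id T0f1 mulVf ?gt_eqF.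
exists f1, T; split; split => //.
(* The lower bound on the norm of [f1] comes from 1 = |T f1| <= |T e| |f1| = |f1|. *)
- apply/eqP; rewrite eq_le f1_le/=.
  by have := positive_operator_norm_le T_pos f1; rewrite Te mul1r Tf1.
- by split; [exact: positive_operator_bounded|rewrite positive_operator_opnorm].
- by rewrite (le_lt_trans f1f0)// /r; lra.
- have := opnorm_rescale_sub_le T0_pos ST0_pos; rewrite -/e t0 t1 => /(_ isT).
  by move/le_lt_trans; apply; lra.
Qed.

Theorem theorem2p5 (R : realType) (d1 d2 : measure_display)
    (Omega1 : measurableType d1) (Omega2 : measurableType d2)
    (mu : {measure set Omega1 -> \bar R}) (nu : {measure set Omega2 -> \bar R}) :
  BPBp_positive (Linfty mu) (L1 nu) /\
  forall eps : R, 0 < eps < 1 ->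
  exists eta : R, 0 < eta < eps /\
    forall S : {linear Linfty mu -> L1 nu},
    operator_sphere S -> positive_operator S ->
    forall f0 : Linfty mu, `|f0| = 1 -> `|S f0| > 1 - eta ->
    exists (f1 : Linfty mu) (T : {linear Linfty mu -> L1 nu}),
      [/\ `|f1| = 1, operator_sphere T & positive_operator T] /\
      [/\ `|T f1| = 1, `|f1 - f0| < eps, opnorm (T \- S) < eps
        & 0 <=L f0 -> 0 <=L f1].
Proof.
have eta_bounds (eps : R) : 0 < eps < 1 -> 0 < eps ^+ 2 / 16 < eps.
  move=> /andP[eps0 eps1]; rewrite divr_gt0 ?exprn_gt0//=.
  have : eps ^+ 2 < eps by rewrite expr2 gtr_pMl.
  by lra.
(* The same eta serves both claims; the first one just forgets the sign of [f1]. *)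
split=> eps eps01; exists (eps ^+ 2 / 16); split; try exact: eta_bounds.
  move=> S S1 S0 f0 f01 Sf0.
  have [f1 [T [? []]]] := Linfty_L1_BPBp_positive eps01 S1 S0 f01 Sf0.
  by exists f1, T.
by move=> S S1 S0 f0; exact: Linfty_L1_BPBp_positive.
Qed.
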